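(* Let $k$ be a positive integer and let $b \geq 3$ be an integer. If $S \subsetneq [0,b-1]$ is a proper subset of the integers in $[0,b-1]$ such that $S$ is $k$-free mod $b$ and $0 \in S$, then the Kempner set $\mathcal{K}(S,b)$ is $k$-free.
   Context: Intervals such as $[0,b-1]$ denote sets of integers. A set of integers is called $k$-free if it contains no arithmetic progression of length $k$, i.e. no $\{c+\Delta j : 0 \le j \le k-1\}$ with $c,\Delta$ integers and $\Delta \geq 1$. A set $S \subset [0,b-1]$ is called $k$-free mod $b$ if it contains no arithmetic progression mod $b$ of length $k$; that is, there do not exist integers $c, \Delta$ with $b \nmid \Delta$ such that, for every $j \in \{0,1,\dots,k-1\}$, the residue of $c+\Delta j$ modulo $b$ (taken in $[0,b-1]$) lies in $S$. It is not required that $\gcd(\Delta,b)=1$, and the residues need not be distinct (so for example $\{1,3,5\}$ contains arithmetic progressions mod $6$ of every length). For an integer $b\ge 2$ and a proper subset $S \subsetneq [0,b-1]$, the Kempner set $\mathcal{K}(S,b)$ is the set of non-negative integers all of whose base-$b$ digits belong to $S$ (the integer $0$ has the single digit $0$). *)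

(* Defs.v *)
From HB Require Import structures.
From mathcomp Require Import all_boot all_order all_algebra.
From mathcomp Require Import boolp classical_sets.

Set Implicit Arguments.
Unset Strict Implicit.
Unset Printing Implicit Defensive.

Import Order.TTheory GRing.Theory Num.Theory.
Local Open Scope classical_set_scope.
Local Open Scope ring_scope.

Definition kfree (k : nat) (A : set int) : Prop :=
  ~ exists c D : int,
      1 <= D /\ [set c + D * j%:Z | j in [set j : nat | (j < k)%N]] `<=` A.

(* The residues need not be distinct: D may share a factor with b, and only
   D = 0 modulo b is excluded. *)
Definition kfree_mod (k b : nat) (S : set int) : Prop :=
  ~ exists c D : int,
      ~~ (b%:Z %| D)%Z /\
      forall j : nat, (j < k)%N -> S ((c + D * j%:Z) %% b%:Z)%Z.

(* Least significant digit first, without leading zeros; for b > 1 the length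
   is (trunc_log b n).+1, which is 1 for n = 0, so digits b 0 = [:: 0]. *)
Definition digits (b n : nat) : seq nat :=
  [seq ((n %/ b ^ i) %% b)%N | i <- iota 0 (trunc_log b n).+1].

Definition kempner (S : set int) (b : nat) : set int :=
  [set n%:Z | n in [set n : nat | forall d : nat, d \in digits b n -> S d%:Z]].

(* Main.v *)
Require Import Defs.
From HB Require Import structures.
From mathcomp Require Import all_boot all_order all_algebra.
From mathcomp Require Import boolp classical_sets.

Set Implicit Arguments.
Unset Strict Implicit.
Unset Printing Implicit Defensive.

Import Order.TTheory GRing.Theory Num.Theory.
Local Open Scope classical_set_scope.
Local Open Scope ring_scope.

(** Suppose that [c + D * j], for [j < k], all lie in the Kempner set, and let
[b ^ m] be the largest power of [b] dividing [D], say [D = q * b ^ m] with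
[b] not dividing [q].  Adding multiples of [D] to [c] never disturbs the [m]
lowest digits, so no carry reaches position [m] and the digit of [c + D * j]
there is [c %/ b ^ m + q * j] modulo [b].  These digits form a [k]-term
progression modulo [b] with difference [q], and they all lie in [S]: the
hypothesis [S 0] takes care of the positions beyond the leading digit
([kempner_digit]).  This contradicts that [S] is [k]-free modulo [b]. *)

(** When [S 0] holds, the digits of an element of the Kempner set are in [S] at
every position, including the padding zeros above the leading digit. *)
Lemma kempner_digit (S : set int) (b n i : nat) :
  (1 < b)%N -> S 0 -> kempner S b n%:Z -> S ((n %/ b ^ i) %% b)%N%:Z.
Proof.
move=> b_gt1 S0 [n' Sn' [eq_n]]; rewrite -eq_n.
case: (ltnP i (trunc_log b n').+1) => [lt_i|ge_i].
  by apply: Sn'; apply/mapP; exists i; rewrite // mem_iota.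
rewrite divn_small ?mod0n //.
by apply: leq_trans (trunc_log_ltn n' b_gt1) _; rewrite leq_exp2l.
Qed.

(** Here [b] need not be prime, so [logn] does not provide the exponent. *)
Lemma max_power_factor (b d : nat) :
  (1 < b)%N -> (0 < d)%N ->
  exists m q : nat, d = (q * b ^ m)%N /\ ~~ (b %| q)%N.
Proof.
move=> b_gt1 d_gt0.
have ex_m : exists m, ~~ (b ^ m.+1 %| d)%N.
  exists d; apply/negP => /(dvdn_leq d_gt0).
  by rewrite leqNgt (ltn_trans _ (ltn_expl d.+1 b_gt1)).
case: (ex_minnP ex_m) => m ndvd min_m.
have /dvdnP[q def_d] : (b ^ m %| d)%N.
  case: m {ndvd} min_m => [|m] min_m; first by rewrite expn0 dvd1n.
  by apply/negPn/negP => /min_m; rewrite ltnn.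
exists m, q; split=> //; apply: contra ndvd => dvd_q.
by rewrite def_d expnS dvdn_mul.
Qed.

Theorem theorem1p2 (k b : nat) (S : set int)
  (hk : (0 < k)%N) (hb : (3 <= b)%N)
  (hS : S `<` [set x : int | 0 <= x <= b%:Z - 1])
  (hfree : kfree_mod k b S) (h0 : S 0) :
  kfree k (kempner S b).
Proof.
have b_gt1 : (1 < b)%N by apply: ltnW.
move=> [c [D [D_ge1 sub]]].
have [d def_D] : exists d : nat, D = d%:Z.
  by case: D D_ge1 {sub} => // d _; exists d.
have [c0 def_c] : exists c0 : nat, c = c0%:Z.
  (* The term j = 0 of the progression is c, a member of the Kempner set. *)
  have [|n _ <-] := sub c; last by exists n.
  by exists 0%N => //=; rewrite mulr0 addr0.
subst D c.
have [m [q [def_d ndvd_q]]] := max_power_factor b_gt1 (D_ge1 : (0 < d)%N).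
apply: hfree; exists (c0 %/ b ^ m)%N%:Z, q%:Z; split=> // j lt_jk.
have /(kempner_digit m b_gt1 h0) : kempner S b (c0 + d * j)%N%:Z.
  by apply: sub; exists j => //; rewrite PoszD PoszM.
rewrite def_d mulnAC addnC divnMDl ?expn_gt0 1?ltnW // addnC.
by rewrite -PoszM -PoszD modz_nat.
Qed.
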